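(* Let $(P,\cdot)$ be a polygroupoid, and put $$N^1_{\mu}(P,\cdot)=\{a\in P \mid (x\cdot a)\cdot y=x\cdot(a\cdot y)\ \ \forall\, x,y\in P\},$$ $$N^2_{\mu}(P,\cdot)=\{a\in P \mid (X\cdot a)\cdot y=X\cdot(a\cdot y)\ \ \forall\, X\subseteq P,\ y\in P\},$$ $$N^3_{\mu}(P,\cdot)=\{a\in P \mid (x\cdot a)\cdot Y=x\cdot(a\cdot Y)\ \ \forall\, x\in P,\ Y\subseteq P\},$$ $$N^4_{\mu}(P,\cdot)=\{a\in P \mid (X\cdot a)\cdot Y=X\cdot(a\cdot Y)\ \ \forall\, X,Y\subseteq P\}.$$ Then the following are true: (a) $N^1_{\mu}(P,\cdot)\subseteq N^2_{\mu}(P,\cdot)$; (b) $N^1_{\mu}(P,\cdot)\subseteq N^3_{\mu}(P,\cdot)$; (c) $N^1_{\mu}(P,\cdot)\subseteq N^4_{\mu}(P,\cdot)$; (d) $N^2_{\mu}(P,\cdot)\subseteq N^4_{\mu}(P,\cdot)$; (e) $N^3_{\mu}(P,\cdot)\subseteq N^4_{\mu}(P,\cdot)$.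
   Context: A polygroupoid (also called a hypergroupoid) is a pair $(P,\cdot)$ where $P$ is a non-empty set and $\cdot: P\times P\to\mathcal{P}^{*}(P)$ is a hyperoperation, $\mathcal{P}^{*}(P)$ being the family of non-empty subsets of $P$. The hyperoperation is extended to subsets $A,B\subseteq P$ by $A\cdot B=\bigcup_{a\in A,\,b\in B} a\cdot b$, and an element $x\in P$ occurring in a product with a subset is identified with the singleton $\{x\}$; thus for $a,x,y\in P$, $(x\cdot a)\cdot y=\bigcup_{w\in x\cdot a} w\cdot y$ and $x\cdot(a\cdot y)=\bigcup_{z\in a\cdot y} x\cdot z$. The set $N^i_{\mu}(P,\cdot)$, $i=1,2,3,4$, is called the first, second, third, fourth middle nucleus of $(P,\cdot)$, respectively. *)

(* Defs.v *)
From mathcomp Require Import all_boot.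
From mathcomp Require Import boolp classical_sets.

Set Implicit Arguments.
Unset Strict Implicit.
Unset Printing Implicit Defensive.

Local Open Scope classical_set_scope.

Record polygroupoid := Polygroupoid {
  carrier :> Type;
  hop : carrier -> carrier -> set carrier;
  carrier_nonempty : [set: carrier] !=set0;
  hop_nonempty : forall x y, hop x y !=set0 }.

(* [A] and [B] may be empty; a product with an empty set is empty. *)
Definition sprod (P : polygroupoid) (A B : set P) : set P :=
  \bigcup_(a in A) \bigcup_(b in B) hop a b.

(* An element multiplied with a subset is identified with its singleton, while
   the product of two elements is [hop]. *)
Definition middle_nucleus1 (P : polygroupoid) : set P :=
  [set a | forall x y : P,
     sprod (hop x a) [set y] = sprod [set x] (hop a y)].

Definition middle_nucleus2 (P : polygroupoid) : set P :=
  [set a | forall (X : set P) (y : P),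
     sprod (sprod X [set a]) [set y] = sprod X (hop a y)].

Definition middle_nucleus3 (P : polygroupoid) : set P :=
  [set a | forall (x : P) (Y : set P),
     sprod (hop x a) Y = sprod [set x] (sprod [set a] Y)].

Definition middle_nucleus4 (P : polygroupoid) : set P :=
  [set a | forall X Y : set P,
     sprod (sprod X [set a]) Y = sprod X (sprod [set a] Y)].

Arguments middle_nucleus1 P : clear implicits.
Arguments middle_nucleus2 P : clear implicits.
Arguments middle_nucleus3 P : clear implicits.
Arguments middle_nucleus4 P : clear implicits.

(* Main.v *)
Require Import Defs.
From mathcomp Require Import all_boot.
From mathcomp Require Import boolp classical_sets.
Local Open Scope classical_set_scope.

(** The product of subsets is defined by unions, so it distributes over
    arbitrary unions in each argument. Since every set is the union of its
    singletons, both sides of [(X a) Y = X (a Y)] are the unions, over [x] in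
    [X] and [y] in [Y], of the corresponding sides of [(x a) y = x (a y)]: the
    identity for elements implies the one for subsets ([nucleus1_sub4]).
    Conversely, taking singletons for [X] or [Y] specialises the fourth nucleus
    to the second and third, and these to the first. Hence the four middle
    nuclei coincide, which contains all five inclusions. *)

Lemma sprod11 (P : polygroupoid) (x y : P) :
  sprod [set x] [set y] = hop x y.
Proof. by rewrite /sprod !bigcup_set1. Qed.

Lemma sprod_bigcupl (P : polygroupoid) (I : Type) (D : set I)
    (F : I -> set P) (B : set P) :
  sprod (\bigcup_(i in D) F i) B = \bigcup_(i in D) sprod (F i) B.
Proof.
apply/seteqP; split=> z.
  by case=> u [i Di Fiu] uBz; exists i => //; exists u.
by case=> i Di [u Fiu uBz]; exists u => //; exists i.
Qed.

Lemma sprod_bigcupr (P : polygroupoid) (I : Type) (D : set I)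
    (A : set P) (F : I -> set P) :
  sprod A (\bigcup_(i in D) F i) = \bigcup_(i in D) sprod A (F i).
Proof.
apply/seteqP; split=> z.
  by case=> u Au [v [i Di Fiv] uvz]; exists i => //; exists u => //; exists v.
by case=> i Di [u Au [v Fiv uvz]]; exists u => //; exists v => //; exists i.
Qed.

Lemma nucleus1_sub4 (P : polygroupoid) :
  middle_nucleus1 P `<=` middle_nucleus4 P.
Proof.
move=> a a1 X Y.
(* [X] and [Y] become the unions of their singletons. *)
rewrite -[X]image_id -[Y]image_id -!bigcup_imset1.
rewrite !sprod_bigcupl; apply: eq_bigcupr => x _; rewrite !sprod_bigcupr.
by apply: eq_bigcupr => y _; rewrite !sprod11.
Qed.

Lemma nucleus2_sub1 (P : polygroupoid) :
  middle_nucleus2 P `<=` middle_nucleus1 P.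
Proof. by move=> a a2 x y; rewrite -a2 sprod11. Qed.

Lemma nucleus3_sub1 (P : polygroupoid) :
  middle_nucleus3 P `<=` middle_nucleus1 P.
Proof. by move=> a a3 x y; rewrite a3 sprod11. Qed.

Lemma nucleus4_sub2 (P : polygroupoid) :
  middle_nucleus4 P `<=` middle_nucleus2 P.
Proof. by move=> a a4 X y; rewrite a4 sprod11. Qed.

Lemma nucleus4_sub3 (P : polygroupoid) :
  middle_nucleus4 P `<=` middle_nucleus3 P.
Proof. by move=> a a4 x Y; rewrite -a4 sprod11. Qed.

Theorem theorem3p2 (P : polygroupoid) :
  middle_nucleus1 P `<=` middle_nucleus2 P /\
  middle_nucleus1 P `<=` middle_nucleus3 P /\
  middle_nucleus1 P `<=` middle_nucleus4 P /\
  middle_nucleus2 P `<=` middle_nucleus4 P /\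
  middle_nucleus3 P `<=` middle_nucleus4 P.
Proof.
have N14 := @nucleus1_sub4 P.
split; first exact: subset_trans N14 (@nucleus4_sub2 P).
split; first exact: subset_trans N14 (@nucleus4_sub3 P).
split; first exact: N14.
split; first exact: subset_trans (@nucleus2_sub1 P) N14.
exact: subset_trans (@nucleus3_sub1 P) N14.
Qed.
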